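(* Let $q=4$, let $e>3$ be an even integer with $e\not\equiv 0\pmod{10}$, and let $n=1\cdot q^0+2\cdot q^2+2\cdot q^{e-1}+1\cdot q^e+2\cdot q^{e+2}$. Then $g_{n,q}$ is a permutation polynomial of $\mathbb{F}_{q^e}$.
   Context: For a prime power $q$ (a power of the prime $p$) and an integer $n\ge 0$, $g_{n,q}\in\mathbb{F}_p[X]$ denotes the unique polynomial satisfying $\sum_{a\in\mathbb{F}_q}(X+a)^n=g_{n,q}(X^q-X)$. A polynomial over $\mathbb{F}_{q^e}$ is a permutation polynomial of $\mathbb{F}_{q^e}$ if the map it induces on $\mathbb{F}_{q^e}$ is a bijection. *)

(* Defs.v *)
From HB Require Import structures.
From mathcomp Require Import all_boot all_order all_fingroup all_algebra all_field.
From mathcomp Require Import zify.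

Set Implicit Arguments.
Unset Strict Implicit.
Unset Printing Implicit Defensive.

Import GRing.Theory.
Local Open Scope ring_scope.

(* Image in R of the representative of c in {0, ..., p - 1}: this is the
   canonical embedding of 'F_p when R has characteristic p (Fp_emb below), and
   not a morphism otherwise. *)
Definition Fp_inj (p : nat) (R : nzRingType) (c : 'F_p) : R := (c : nat)%:R.
Arguments Fp_inj {p} R c.

Definition Fp_emb (p : nat) (R : nzRingType) (chR : p \in [pchar R]) :
  'F_p -> R := @Fp_inj p R.

Lemma natr_modp (p : nat) (R : nzRingType) (chR : p \in [pchar R]) (m : nat) :
  (m %% p)%:R = m%:R :> R.
Proof. by rewrite {2}(divn_eq m p) natrD natrM (pcharf0 chR) mulr0 add0r. Qed.

Lemma Fp_emb_natr (p : nat) (R : nzRingType) (chR : p \in [pchar R]) (m : nat) :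
  Fp_emb chR m%:R = m%:R.
Proof.
by rewrite /Fp_emb /Fp_inj val_Fp_nat ?natr_modp // (pcharf_prime chR).
Qed.

Lemma Fp_emb_zmod (p : nat) (R : nzRingType) (chR : p \in [pchar R]) :
  zmod_morphism (Fp_emb chR).
Proof.
have D : {morph Fp_emb chR : x y / x + y}.
  move=> x y; rewrite -{1}(natr_Zp x) -{1}(natr_Zp y) -natrD Fp_emb_natr.
  by rewrite natrD.
by move=> x y; apply: (addIr (Fp_emb chR y)); rewrite -D !subrK.
Qed.

Lemma Fp_emb_monoid (p : nat) (R : nzRingType) (chR : p \in [pchar R]) :
  monoid_morphism (Fp_emb chR).
Proof.
split=> [|x y]; first exact: (Fp_emb_natr chR 1).
rewrite -{1}(natr_Zp x) -{1}(natr_Zp y) -natrM Fp_emb_natr.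
by rewrite natrM.
Qed.

HB.instance Definition _ (p : nat) (R : nzRingType) (chR : p \in [pchar R]) :=
  GRing.isZmodMorphism.Build 'F_p R (Fp_emb chR) (Fp_emb_zmod chR).
HB.instance Definition _ (p : nat) (R : nzRingType) (chR : p \in [pchar R]) :=
  GRing.isMonoidMorphism.Build 'F_p R (Fp_emb chR) (Fp_emb_monoid chR).

Definition is_gnq (p : nat) (Fq : finFieldType) (n : nat) (g : {poly 'F_p}) :
    bool :=
  \sum_(a : Fq) ('X + a%:P) ^+ n
    == map_poly (Fp_inj Fq) g \Po ('X^#|Fq| - 'X).

Lemma natr_card0 (F : finFieldType) : #|F|%:R = 0 :> F.
Proof.
apply: (addrI (\sum_(a : F) a)); rewrite addr0.
rewrite [RHS](reindex_inj (addIr 1)) big_split /=; congr (_ + _).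
by rewrite sumr_const.
Qed.

Lemma sum_expf (F : finFieldType) (k : nat) : (k < #|F|)%N ->
  \sum_(a : F) a ^+ k = if k == #|F|.-1 then -1 else 0.
Proof.
have q1 := finNzRing_gt1 F; move=> ltk; case: eqP => [->|/eqP nek].
  rewrite (bigD1 0) //= expr0n -subn1 subn_eq0 leqNgt q1 /= add0r.
  rewrite (eq_bigr (fun=> 1)) => [|a a0]; last first.
    apply: (mulIf a0); rewrite -exprSr subn1 prednK ?expf_card ?mul1r //.
    exact: ltnW.
  rewrite sumr_const (_ : #|_| = #|F|.-1); last first.
    by rewrite -(cardC1 (0%R : F)); apply: eq_card => x; rewrite !inE.
  apply: (addIr 1); rewrite addNr natr1 prednK ?natr_card0 //; exact: ltnW.
have {}ltk : (k < #|F|.-1)%N.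
  by rewrite ltn_neqAle nek -ltnS prednK // ltnW.
case: k => [|k] in ltk nek *.
  rewrite (eq_bigr (fun=> 1)) => [|a _]; last by rewrite expr0.
  by rewrite sumr_const natr_card0.
have [b b0 bk] : exists2 b : F, b != 0 & b ^+ k.+1 != 1.
  case: (pickP [pred b : F | (b != 0) && (b ^+ k.+1 != 1)]) => [b|noB].
    by case/andP; exists b.
  have : (size (enum (predC1 (0%R : F))) <= k.+1)%N.
    apply: max_unity_roots; rewrite ?enum_uniq //.
    apply/allP => b; rewrite mem_enum /= !inE => b0.
    by have := noB b; rewrite /= b0 /= unity_rootE => /negbFE.
  by rewrite -cardE cardC1 leqNgt ltk.
set S := \sum_a _; have : S = b ^+ k.+1 * S.
  rewrite /S mulr_sumr (reindex_inj (mulfI b0)) /=.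
  by apply: eq_bigr => a _; rewrite exprMn.
move/eqP; rewrite -subr_eq0 -{1}(mul1r S) -mulrBl mulf_eq0 subr_eq0 eq_sym.
by rewrite (negbTE bk) => /eqP.
Qed.

Lemma is_gnq_emb (p : nat) (Fq : finFieldType) (chF : p \in [pchar Fq])
    (n : nat) (g : {poly 'F_p}) :
  is_gnq Fq n g = (\sum_(a : Fq) ('X + a%:P) ^+ n
                     == map_poly (Fp_emb chF) g \Po ('X^#|Fq| - 'X)).
Proof. by []. Qed.

Lemma exists_gnq (p : nat) (Fq : finFieldType) (n : nat) :
  p \in [pchar Fq] -> exists g : {poly 'F_p}, is_gnq Fq n g.
Proof.
move=> chF; have q1 := finNzRing_gt1 Fq.
elim/ltn_ind: n => n IH; have [ltnq|leqn] := ltnP n #|Fq|.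
  exists (if n == #|Fq|.-1 then -1 else 0); rewrite (is_gnq_emb chF).
  have -> : map_poly (Fp_emb chF) (if n == #|Fq|.-1 then -1 else 0)
              = (if n == #|Fq|.-1 then -1 else 0)%:P.
    by case: ifP => _; rewrite ?rmorphN ?rmorph1 ?rmorph0 ?polyCN ?polyC1.
  rewrite comp_polyC -sum_expf //; apply/eqP.
  under eq_bigr => a _ do rewrite addrC exprDn.
  rewrite exchange_big big_ord_recl /= [X in _ + X]big1 ?addr0 => [|i _].
    rewrite [RHS]rmorph_sum; apply: eq_bigr => a _ /=.
    by rewrite subn0 expr0 mulr1 bin0 mulr1n rmorphXn.
  under eq_bigr => a _ do rewrite -mulrnAr -rmorphXn.
  have lti := ltn_ord i; rewrite -mulr_suml -rmorph_sum sum_expf /=; last first.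
    exact: leq_ltn_trans (leq_subr _ _) ltnq.
  have ki : (n - bump 0 i < #|Fq|.-1)%N.
    rewrite /bump leq0n add1n; move: (nat_of_ord i) (lti) => k lt_kn.
    move: #|Fq| q1 ltnq => q; lia.
  by rewrite ifN ?mul0r // neq_ltn ki.
have [lt1 lt2] : (n - #|Fq| < n)%N /\ ((n - #|Fq|).+1 < n)%N.
  by move: #|Fq| q1 leqn => q; lia.
have [g1 /eqP e1] := IH _ lt1; have [g2 /eqP e2] := IH _ lt2.
exists ('X * g1 + g2); rewrite (is_gnq_emb chF); apply/eqP.
rewrite rmorphD rmorphM /= map_polyX comp_polyD comp_polyM comp_polyX.
rewrite -e1 -e2 mulr_sumr -big_split /=; apply: eq_bigr => a _.
rewrite exprSr mulrC -mulrDr -{1}(subnK leqn) exprD; congr (_ * _).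
have qnat : [pchar {poly Fq}].-nat #|Fq|.
  rewrite (card_pprimeChar chF) pnatX; apply/orP; left.
  by rewrite (eq_pnat _ (pchar_poly _)) pnatE ?(pcharf_prime chF).
rewrite exprDn_pchar // -polyC_exp expf_card.
by rewrite addrA subrK.
Qed.

(* g_{n,q} for q = #|Fq|; by gnqP and gnq_unique it is the only polynomial
   over 'F_p satisfying the functional equation. *)
Definition gnq (p : nat) (Fq : finFieldType) (chF : p \in [pchar Fq])
    (n : nat) : {poly 'F_p} :=
  xchoose (exists_gnq n chF).

Lemma gnqP (p : nat) (Fq : finFieldType) (chF : p \in [pchar Fq]) (n : nat) :
  \sum_(a : Fq) ('X + a%:P) ^+ n
    = map_poly (Fp_inj Fq) (gnq chF n) \Po ('X^#|Fq| - 'X).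
Proof. exact/eqP/(xchooseP (exists_gnq n chF)). Qed.

Lemma gnq_unique (p : nat) (Fq : finFieldType) (chF : p \in [pchar Fq])
    (n : nat) (g : {poly 'F_p}) :
  \sum_(a : Fq) ('X + a%:P) ^+ n
    = map_poly (Fp_inj Fq) g \Po ('X^#|Fq| - 'X) ->
  g = gnq chF n.
Proof.
rewrite (gnqP chF) => /eqP; rewrite -[Fp_inj Fq]/(Fp_emb chF : 'F_p -> Fq).
rewrite eq_sym -subr_eq0 -comp_polyB comp_poly_eq0; last first.
  have q1 := finNzRing_gt1 Fq.
  by rewrite size_polyDl size_polyXn ?size_polyN ?size_polyX // ltnW.
by rewrite subr_eq0 => /eqP/(map_inj_poly (fmorph_inj _) (rmorph0 _)).
Qed.

Definition is_perm_poly (p : nat) (K : finFieldType) (f : {poly 'F_p}) : Prop :=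
  bijective (fun x : K => (map_poly (Fp_inj K) f).[x]).
Arguments is_perm_poly {p} K f.

(* Main.v *)
(* With y = X^4 - X and t = X + a, each t^(4^k) is t plus a partial sum of
   y + y^4 + y^16 + ..., so (X + a)^n is a polynomial in t and y.  Summing over
   a in F_4 extracts its t^3 coefficient modulo t^4 = t + y, which is g(y).
   On F_(4^e), putting y = z^4 and T = Tr(z) (the trace to F_4), this reads
     f(z) = z^2 + T^2 + T (z^4 + z^16 + z^64) + T^3 (z^2 + z^8 + z^32).
   Since e is even, Tr (f(z)) = T^2, so f determines T; for fixed T the map f is
   affine over F_2.  For T = 0 it is z^2; for T <> 0 the substitution z = T x
   takes its kernel to the roots of v + v^2 + v^4 + v^8 + v^16 with v = x^4.
   Such roots lie in F_32, hence in F_2 as 5 does not divide 2e, hence vanish. *)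
Require Import Defs.
From mathcomp Require Import all_boot all_order all_fingroup all_algebra all_field.
From mathcomp Require Import zify ring.

Set Implicit Arguments.
Unset Strict Implicit.
Unset Printing Implicit Defensive.

Import GRing.Theory.
Local Open Scope ring_scope.

(** For [k = e] on a field with 4^e elements this is the trace to F_4; other [k] give truncated or
    overlong traces. *)
Definition qsum4 (R : nzRingType) (k : nat) (y : R) : R :=
  \sum_(i < k) y ^+ (4 ^ i).

(* P(t) = t (t + A) (t^2 + b) (t^2 + c) (t^2 + d) is the value of (X + a)^n for
   t = X + a and y = X^4 - X; gform is the t^3 coefficient of P modulo
   t^4 = t + y. *)
Definition gform (R : nzRingType) (e : nat) (y : R) : R :=
  let A := qsum4 e y in
  let b := qsum4 2 y ^+ 2 in
  let c := qsum4 (e - 1) y ^+ 2 in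
  let d := qsum4 (e + 2) y ^+ 2 in
  A * y + (b + c + d) + A * (b * c + b * d + c * d).

Lemma rmorph_qsum4 (R S : nzRingType) (f : {rmorphism R -> S}) k y :
  f (qsum4 k y) = qsum4 k (f y).
Proof. by rewrite rmorph_sum; apply: eq_bigr => i _; rewrite rmorphXn. Qed.

(** Lets [gform] pass through base change, composition and evaluation of polynomials. *)
Lemma rmorph_gform (R S : nzRingType) (f : {rmorphism R -> S}) e y :
  f (gform e y) = gform e (f y).
Proof. by rewrite /gform !(rmorphD, rmorphM, rmorphXn) /= !rmorph_qsum4. Qed.

(** * Frobenius powers in characteristic 2 *)

Section Char2.

Variables (R : comNzRingType) (ch2 : 2%N \in [pchar R]).
Implicit Types x y t : R.

(** Brings identities of characteristic 2 within reach of [ring]: [w] collects the terms that cancel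
    in pairs. *)
Lemma eq_mod2 x y w : x = y + 2 * w -> x = y.
Proof. by rewrite (pcharf0 ch2) mul0r addr0. Qed.

Lemma sqrD_char2 x y : (x + y) ^+ 2 = x ^+ 2 + y ^+ 2.
Proof. by rewrite sqrrD mulrn_pchar // addr0. Qed.

Lemma exprD_2exp k x y : (x + y) ^+ (2 ^ k) = x ^+ (2 ^ k) + y ^+ (2 ^ k).
Proof. by apply: exprDn_pchar; rewrite pnatX pnatE ?ch2. Qed.

Lemma exprD_4exp k x y : (x + y) ^+ (4 ^ k) = x ^+ (4 ^ k) + y ^+ (4 ^ k).
Proof. by rewrite -[4%N]/(2 ^ 2)%N -expnM exprD_2exp. Qed.

Lemma expr_sum_2exp k n (F : 'I_n -> R) :
  (\sum_(i < n) F i) ^+ (2 ^ k) = \sum_(i < n) F i ^+ (2 ^ k).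
Proof.
apply: (big_morph (fun x => x ^+ (2 ^ k))) => [x y|]; first exact: exprD_2exp.
by rewrite expr0n expn_eq0.
Qed.

Lemma qsum4D k x y : qsum4 k (x + y) = qsum4 k x + qsum4 k y.
Proof. by rewrite -big_split; apply: eq_bigr => i _; rewrite exprD_4exp. Qed.

Lemma qsum4X k j x : qsum4 k (x ^+ (2 ^ j)) = qsum4 k x ^+ (2 ^ j).
Proof. by rewrite expr_sum_2exp; apply: eq_bigr => i _; rewrite exprAC. Qed.

(** The sum of the conjugates of t^4 - t telescopes. *)
Lemma expr_4exp_qsum4 k t : t ^+ (4 ^ k) = t + qsum4 k (t ^+ 4 - t).
Proof.
rewrite /qsum4; elim: k => [|k IH]; first by rewrite big_ord0 addr0.
rewrite big_ord_recr /= addrA -IH (oppr_pchar2 ch2) exprD_4exp addrCA.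
by rewrite (addrr_pchar2 ch2) addr0 -exprM -expnS.
Qed.

End Char2.

(** * Closed form of g over F_4 *)

Section FourElements.

Variables (F : finFieldType) (chF : 2%N \in [pchar F]) (cardF : #|F| = 4%N).

Lemma card4_0 : 4%:R = 0 :> F.
Proof. by rewrite -cardF natr_card0. Qed.

Lemma sum_translate_const (c : {poly F}) : \sum_(a : F) c = 0.
Proof. by rewrite sumr_const cardF -mulr_natl -polyC_natr card4_0 mul0r. Qed.

(** Binomial expansion leaves power sums over F_4 with exponents at most 3; only exponent 3
    survives, with value -1 = 1. *)
Lemma sum_translate_exp k : (0 < k < 4)%N ->
  \sum_(a : F) ('X + a%:P) ^+ k = (if k == 3%N then 1 else 0) :> {poly F}.
Proof.
have s j : (j < 4)%N -> \sum_(a : F) (a%:P : {poly F}) ^+ j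
    = (if j == 3%N then 1 else 0).
  move=> lj; under eq_bigr do rewrite -rmorphXn.
  rewrite -rmorph_sum sum_expf ?cardF //=; case: eqP => _; rewrite ?rmorph0 //.
  by rewrite (oppr_pchar2 chF) rmorph1.
move=> /andP[k0 k4]; under eq_bigr do rewrite exprDn.
rewrite exchange_big big_ord_recr /= subnn big1 ?add0r => [|i _].
  by rewrite binn -s //; apply: eq_bigr => a _; rewrite expr0 mul1r.
rewrite sumrMnl -mulr_sumr s; last exact: ltn_trans k4.
by rewrite ltn_eqF ?mulr0 ?mul0rn //; apply: leq_trans (ltn_ord i) _.
Qed.

Lemma gnq_gform e :
  gnq chF (1 * 4 ^ 0 + 2 * 4 ^ 2 + 2 * 4 ^ (e - 1) + 1 * 4 ^ e
           + 2 * 4 ^ (e + 2))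
  = gform e 'X.
Proof.
apply/esym/gnq_unique.
have chP : 2%N \in [pchar {poly F}] by rewrite pchar_poly.
rewrite -[Fp_inj F]/(Fp_emb chF : 'F_2 -> F) rmorph_gform /= map_polyX.
rewrite -[_ \Po _]/(comp_poly _ _) rmorph_gform /= comp_polyX cardF.
set Y := 'X^4 - 'X.
have tY a : ('X + a%:P) ^+ 4 = 'X + a%:P + Y.
  have a4 : a ^+ 4 = a by rewrite -cardF expf_card.
  rewrite -[4%N]/(4 ^ 1)%N exprD_4exp // -rmorphXn /= a4 /Y; ring.
set A := qsum4 e Y; set b := qsum4 2 Y ^+ 2; set c := qsum4 (e - 1) Y ^+ 2.
set d := qsum4 (e + 2) Y ^+ 2.
pose s1 := b + c + d; pose s2 := b * c + b * d + c * d; pose s3 := b * c * d.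
(* Reduction modulo t^4 = t + Y; only the t^3 term survives summation. *)
have red a (t := 'X + a%:P) :
  t ^+ (1 * 4 ^ 0 + 2 * 4 ^ 2 + 2 * 4 ^ (e - 1) + 1 * 4 ^ e + 2 * 4 ^ (e + 2))
    = t ^+ 3 * gform e Y + t ^+ 2 * (1 + Y * s1 + A * s1 + s3)
      + t ^+ 1 * (2 * Y + A + A * Y * s1 + s2 + A * s3)
      + (Y ^+ 2 + A * Y + Y * s2).
  have t4 : t ^+ 4 = t + Y := tY a.
  have tq k : t ^+ (4 ^ k) = t + qsum4 k Y.
    by rewrite (expr_4exp_qsum4 chP) t4 [t + Y]addrC addrK.
  have t2q k : t ^+ (2 * 4 ^ k) = t ^+ 2 + qsum4 k Y ^+ 2.
    by rewrite mulnC exprM tq (sqrD_char2 chP).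
  move: t t4 tq t2q => t t4 tq t2q.
  rewrite 4!exprD !mul1n expn0 expr1 (t2q 2) (t2q (e - 1)%N) (t2q (e + 2)%N) tq.
  rewrite /gform -/A -/b -/c -/d.
  (* Factors t^4 are kept explicit for substitution; A t^7 leaves A t^4, hence a second round. *)
  transitivity (t ^+ 4 * t ^+ 4 + A * t ^+ 4 * t ^+ 3 + s1 * t ^+ 4 * t ^+ 2
    + A * s1 * t ^+ 4 * t + s2 * t ^+ 4 + A * s2 * t ^+ 3 + s3 * t ^+ 2
    + A * s3 * t); first by rewrite /s1 /s2 /s3; ring.
  rewrite t4.
  transitivity (t ^+ 4 * A
    + t ^+ 3 * (A * Y + s1 + A * s2) + t ^+ 2 * (1 + Y * s1 + A * s1 + s3)
    + t * (2 * Y + A * Y * s1 + s2 + A * s3)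
    + (Y ^+ 2 + Y * s2)); first by ring.
  by rewrite t4 /s1 /s2; ring.
rewrite (eq_bigr _ (fun a _ => red a)) 3!big_split /= -!mulr_suml.
by rewrite !sum_translate_exp //= sum_translate_const mul1r !mul0r !addr0.
Qed.

End FourElements.

(** * Injectivity on the field with 4^e elements *)

Section Permutation.

Variables (K : finFieldType) (e : nat).
Hypotheses (cardK : #|K| = (4 ^ e)%N) (e0 : (0 < e)%N) (even_e : ~~ odd e)
  (e5 : (e %% 5 != 0)%N) (chK : 2%N \in [pchar K]).

Local Notation Tr := (@qsum4 K e).

Lemma expr_4e (x : K) : x ^+ (4 ^ e) = x.
Proof. by rewrite -cardK expf_card. Qed.

Lemma trX4 (x : K) : Tr (x ^+ 4) = Tr x.
Proof.
rewrite /qsum4; case: e e0 expr_4e => // k _ ex.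
rewrite big_ord_recr big_ord_recl /= addrC -exprM -expnS ex; congr (_ + _).
by apply: eq_bigr => i _; rewrite -exprM -expnS.
Qed.

Lemma tr_fixed (x : K) : Tr x ^+ 4 = Tr x.
Proof. by rewrite -[4%N]/(2 ^ 2)%N -qsum4X ?trX4. Qed.

Lemma gform_trace (z : K) (A := Tr z) :
  gform e (z ^+ 4) = z ^+ 2 + A ^+ 2 + A * (z ^+ 4 + z ^+ 16 + z ^+ 64)
    + A ^+ 3 * (z ^+ 2 + z ^+ 8 + z ^+ 32).
Proof.
have hA : A ^+ 4 = A := tr_fixed z.
have q2 : qsum4 2 (z ^+ 4) = z ^+ 4 + z ^+ 16.
  by rewrite /qsum4 !big_ord_recr big_ord0 /= add0r -!exprM.
have qe : Tr (z ^+ 4) = A := trX4 z.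
(* As z^(4^e) = z, length e - 1 misses only the conjugate z of the trace, and length e + 2 repeats
   z^4 and z^16. *)
have qe1 : qsum4 (e - 1) (z ^+ 4) = A + z.
  rewrite -qe; case: e e0 expr_4e => // k _ ex.
  rewrite subn1 /= /qsum4 big_ord_recr /= -(exprM z) -expnS ex -addrA.
  by rewrite (addrr_pchar2 chK) addr0.
have qe2 : qsum4 (e + 2) (z ^+ 4) = A + (z ^+ 4 + z ^+ 16).
  rewrite -qe addn2 /qsum4 !big_ord_recr /= -addrA; congr (_ + (_ + _)).
    exact: expr_4e.
  by rewrite expnS mulnC exprM expr_4e -exprM.
rewrite /gform q2 qe1 qe2 qe !(sqrD_char2 chK) -!exprM.
apply: (eq_mod2 chK (w := z ^+ 8 + z ^+ 32 + A ^+ 2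
  + A * (A ^+ 2 + z ^+ 2) * (z ^+ 8 + z ^+ 32) + A * z ^+ 40)).
(* The expansion produces A^2 in the form A^5, from A * c * d. *)
have -> : z ^+ 2 + A ^+ 2 = z ^+ 2 + A ^+ 4 * A by rewrite hA -expr2.
ring.
Qed.

Lemma expr_fixed4 (a : K) : a ^+ 4 = a ->
  [/\ a ^+ 8 = a ^+ 2, a ^+ 16 = a, a ^+ 32 = a ^+ 2 & a ^+ 64 = a].
Proof.
move=> ha; have e4 k : a ^+ (4 * k) = a ^+ k by rewrite exprM ha.
have e8 : a ^+ 8 = a ^+ 2 := e4 2%N.
have e16 : a ^+ 16 = a := etrans (e4 4%N) ha.
by split=> //; [exact: etrans (e4 8%N) e8 | exact: etrans (e4 16%N) e16].
Qed.

Lemma trZ (a x : K) : a ^+ 4 = a -> Tr (a * x) = a * Tr x.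
Proof.
move=> ha; rewrite /qsum4 mulr_sumr; apply: eq_bigr => i _; rewrite exprMn.
by congr (_ * _); elim: (i : nat) => // j IH; rewrite expnS exprM ha.
Qed.

(** The trace is e * a, and e is even. *)
Lemma tr_const (a : K) : a ^+ 4 = a -> Tr a = 0.
Proof.
move=> ha; rewrite -[a]mulr1 trZ // /qsum4.
rewrite (eq_bigr (fun=> 1)) => [|i _]; last by rewrite expr1n.
rewrite sumr_const card_ord -(odd_double_half e) (negbTE even_e) add0n.
by rewrite -muln2 mulrnA (mulrn_pchar chK) mulr0.
Qed.

(** The two groups with factors A and A^3 both have trace 3 A^2 and cancel; the term A^2 has trace
    0. *)
Lemma tr_gform (z : K) : Tr (gform e (z ^+ 4)) = Tr z ^+ 2.
Proof.
rewrite gform_trace; set A := Tr z.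
have hA : A ^+ 4 = A := tr_fixed z.
have h2A : (A ^+ 2) ^+ 4 = A ^+ 2 by rewrite exprAC hA.
have h3A : (A ^+ 3) ^+ 4 = A ^+ 3 by rewrite exprAC hA.
have t j : Tr (z ^+ (2 ^ j)) = A ^+ (2 ^ j) := qsum4X chK e j z.
rewrite !(qsum4D chK) (tr_const h2A) (trZ _ hA) (trZ _ h3A) !(qsum4D chK).
rewrite (t 1%N) (t 2%N) (t 3%N) (t 4%N) (t 5%N) (t 6%N) /=.
have [e8 e16 e32 e64] := expr_fixed4 hA.
have m5 : A ^+ 3 * A ^+ 2 = A ^+ 2 by rewrite -exprD (exprD A 4 1) hA.
rewrite hA e8 e16 e32 e64 !mulrDr m5.
by apply: (eq_mod2 chK (w := 3 * A ^+ 2)); ring.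
Qed.

Lemma iter_sqr_eq0 (v : K) :
  v + v ^+ 2 + v ^+ 4 + v ^+ 8 + v ^+ 16 = 0 -> v = 0.
Proof.
move=> hv.
have per j k m : v ^+ (2 ^ j) = v -> v ^+ (2 ^ (m * j + k)) = v ^+ (2 ^ k).
  move=> vj; elim: m => // m IH.
  by rewrite mulSn -addnA expnD exprM vj.
(* Adding the equation to its square leaves v + v^32 = 0. *)
have v5 : v ^+ (2 ^ 5) = v.
  have := congr1 (fun x => x ^+ 2) hv; rewrite /= !(sqrD_char2 chK) -!exprM.
  rewrite expr0n mulr0n => hv2.
  rewrite -[RHS]addr0 -[in RHS]hv -[RHS]addr0 -[in RHS]hv2.
  apply: (eq_mod2 chK (w := - (v + v ^+ 2 + v ^+ 4 + v ^+ 8 + v ^+ 16))).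
  by rewrite /=; ring.
have v2e : v ^+ (2 ^ (2 * e)) = v by rewrite expnM expr_4e.
have vr : v ^+ (2 ^ ((2 * e) %% 5)) = v.
  by rewrite -(per 5 _ (2 * e %/ 5)%N v5) -divn_eq.
(* Frobenius periods 5 and r = 2e mod 5, with r nonzero, are coprime, so 1 is a period: 5 + 1 = 3 *
   2 = 2 * 3 and 4 + 1 = 5. *)
have v1 : v ^+ 2 = v.
  have : (2 * e %% 5 \in [:: 1; 2; 3; 4])%N by rewrite !inE; lia.
  rewrite !inE => /or4P[] /eqP er; rewrite er in vr.
  - exact: vr.
  - exact: etrans (esym (per 5 1 1 v5)%N) (per 2 0 3 vr)%N.
  - exact: etrans (esym (per 5 1 1 v5)%N) (per 3 0 2 vr)%N.
  - exact: etrans (esym (per 4 1 1 vr)%N) v5.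
have e2 k : v ^+ (2 * k) = v ^+ k by rewrite exprM v1.
have e4 : v ^+ 4 = v := etrans (e2 2%N) v1.
have e8 : v ^+ 8 = v := etrans (e2 4%N) e4.
have e16 : v ^+ 16 = v := etrans (e2 8%N) e8.
rewrite -[RHS]hv v1 e4 e8 e16.
by apply: (eq_mod2 chK (w := - 2 * v)); ring.
Qed.

Lemma gform_inj : injective (@gform K e).
Proof.
have root4 y : exists z : K, y = z ^+ 4.
  exists (y ^+ (4 ^ (e - 1))).
  by rewrite -exprM -expnSr subn1 prednK // expr_4e.
have sqr_inj (x y : K) : x ^+ 2 = y ^+ 2 -> x = y.
  move=> /eqP; rewrite -subr_eq0 (oppr_pchar2 chK) -(sqrD_char2 chK) sqrf_eq0.
  by rewrite -[y in x + y](oppr_pchar2 chK) subr_eq0 => /eqP.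
move=> y1 y2; have [z1 ->] := root4 y1; have [z2 ->] := root4 y2 => eqg.
have eqA : Tr z1 = Tr z2 by apply: sqr_inj; rewrite -!tr_gform eqg.
congr (_ ^+ 4); move: eqg; rewrite !gform_trace -eqA; set A := Tr z1.
have hA : A ^+ 4 = A := tr_fixed z1.
pose d := z1 + z2 => eqg.
(* With equal traces the constant A^2 cancels and the rest is additive in z. *)
have hd : d ^+ 2 + A * (d ^+ 4 + d ^+ 16 + d ^+ 64)
    + A ^+ 3 * (d ^+ 2 + d ^+ 8 + d ^+ 32) = 0.
  have D k : d ^+ (2 ^ k) = z1 ^+ (2 ^ k) + z2 ^+ (2 ^ k).
    exact: exprD_2exp.
  rewrite (D 1%N) (D 2%N) (D 3%N) (D 4%N) (D 5%N) (D 6%N) /=.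
  move/eqP: eqg; rewrite -subr_eq0 (oppr_pchar2 chK) => /eqP <-.
  by apply: (eq_mod2 chK (w := - A ^+ 2)); ring.
suff /eqP : d = 0.
  by rewrite /d -[z2](oppr_pchar2 chK) subr_eq0 (oppr_pchar2 chK) => /eqP.
have [A0|An0] := eqVneq A 0.
  move: hd; rewrite A0 expr0n /= !mul0r !addr0 => /eqP; rewrite sqrf_eq0.
  by move/eqP.
have A3 : A ^+ 3 = 1 by apply: (mulfI An0); rewrite mulr1 -exprS hA.
(* Rescaling by A turns the additive polynomial into one over F_2. *)
have [x dx] : exists x, d = A * x.
  by exists (A ^+ 2 * d); rewrite mulrA -exprS A3 mul1r.
have [e8 e16 e32 e64] := expr_fixed4 hA.
have /iter_sqr_eq0/eqP : x ^+ 4 + (x ^+ 4) ^+ 2 + (x ^+ 4) ^+ 4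
    + (x ^+ 4) ^+ 8 + (x ^+ 4) ^+ 16 = 0.
  apply: (mulfI (expf_neq0 2 An0)); rewrite mulr0 -hd dx A3 !exprMn.
  rewrite hA e8 e16 e32 e64.
  (* Both d^2 and A^3 d^2 give A^2 x^2; their cancellation leaves only powers of x^4. *)
  by apply: (eq_mod2 chK (w := - (A ^+ 2 * x ^+ 2))); ring.
by rewrite expf_eq0 /= dx => /eqP ->; rewrite mulr0.
Qed.

End Permutation.

Theorem theorem3p4 (q : nat) (hq : q = 4%N)
    (Fq : finFieldType) (chFq : 2%N \in [pchar Fq]) (cardFq : #|Fq| = q)
    (e : nat) (he3 : (3 < e)%N) (he2 : ~~ odd e) (he10 : (e != 0 %[mod 10])%N)
    (K : finFieldType) (cardK : #|K| = (q ^ e)%N)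
    (n : nat)
    (hn : n = (1 * q ^ 0 + 2 * q ^ 2 + 2 * q ^ (e - 1) + 1 * q ^ e
                 + 2 * q ^ (e + 2))%N) :
  is_perm_poly K (gnq chFq n).
Proof.
subst q n.
have e0 : (0 < e)%N by apply: leq_trans he3.
have e5 : (e %% 5 != 0)%N by lia.
have chK : 2%N \in [pchar K].
  by apply: (@card_finPcharP _ _ (2 * e)); rewrite // expnM.
rewrite gnq_gform //; apply: injF_bij => x y.
rewrite -[Fp_inj K]/(Fp_emb chK : 'F_2 -> K) !rmorph_gform /= map_polyX.
rewrite -!horner_evalE !rmorph_gform /= !horner_evalE !hornerX.
exact: (gform_inj cardK).
Qed.
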